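(* Let $X$ be a real Hilbert space and let $\bar x=(x_n)_n$, $\bar y=(y_n)_n$ be bounded sequences in $X$. Then $$\|ac(\bar x)-ac(\bar y)\|^2\le d(\bar x,\bar y)\,\big(ar(\bar x)+ar(\bar y)+d(\bar x,\bar y)\big).$$
   Context: For a bounded sequence $\bar x=(x_n)_n$ in $X$, the asymptotic radius is $ar(\bar x)=\inf_{y\in X}\limsup_n\|x_n-y\|$ and the asymptotic center is the set $\{y\in X:\limsup_n\|x_n-y\|=ar(\bar x)\}$. In a Hilbert space the asymptotic center is always a singleton, and $ac(\bar x)$ denotes its unique element. The $n$-th tail of $\bar x$ is $C_n(\bar x)=\{x_m:m\ge n\}$, $B_X$ is the closed unit ball of $X$, and $d$ is the pseudometric on bounded sequences in $X$ given by $$d(\bar x,\bar y)=\inf\{\varepsilon>0:\ \text{for every } n\in\mathbb{N}\text{ there exists } m\in\mathbb{N}\text{ such that } C_m(\bar x)\subseteq C_n(\bar y)+\varepsilon B_X\text{ and } C_m(\bar y)\subseteq C_n(\bar x)+\varepsilon B_X\}.$$ *)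

(* Defs.v *)
From HB Require Import structures.
From mathcomp Require Import all_boot all_order all_algebra.
From mathcomp Require Import all_classical all_reals all_analysis.

Set Implicit Arguments.
Unset Strict Implicit.
Unset Printing Implicit Defensive.

Import Order.TTheory GRing.Theory Num.Theory.
Import numFieldNormedType.Exports.

Local Open Scope classical_set_scope.
Local Open Scope ring_scope.

Section asymptotic_center.
Context {R : realType} {X : normedModType R}.
Implicit Types (x y : nat -> X) (u : X).

Definition asymp_dist x u : R := limn_sup (fun n => `|x n - u|).

Definition asymp_radius x : R := inf [set asymp_dist x u | u in [set: X]].

Definition asymp_center_set x : set X :=
  [set u | asymp_dist x u = asymp_radius x].

(* The unique element of the asymptotic center; an arbitrary point when that
   set is not a singleton. *)
Definition asymp_center x : X := get [set u | asymp_center_set x = [set u]].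

Definition tail x (n : nat) : set X := [set x m | m in [set m | (n <= m)%N]].

Definition unit_ball : set X := [set u | `|u| <= 1].

Definition thicken (A : set X) (e : R) : set X :=
  [set a + e *: b | a in A & b in unit_ball].

Definition tail_dist x y : R :=
  inf [set e : R | 0 < e /\ forall n, exists m,
         tail x m `<=` thicken (tail y n) e /\
         tail y m `<=` thicken (tail x n) e].

End asymptotic_center.

(* Main.v *)
(* In a Hilbert space the squared asymptotic distance [f u = limsup |x n - u|]
   inherits the strong convexity of the squared norm, so
   [f c ^+ 2 + `|c - u| ^+ 2 <= f u ^+ 2] at a minimizer [c]; this gives existence
   (by completeness) and uniqueness of the asymptotic center.  The asymptotic
   distances of [x] and [y] differ by at most [d := tail_dist x y] at every point.
   Adding the strong convexity inequalities of [x] at the center of [y] and of [y]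
   at the center of [x] then yields twice the claimed bound. *)
Require Import Defs.
From mathcomp Require Import all_boot all_order all_algebra.
From mathcomp Require Import all_classical all_reals all_analysis.
From mathcomp Require Import ring lra.
Import Order.TTheory GRing.Theory Num.Theory.
Import numFieldNormedType.Exports.
Local Open Scope classical_set_scope.
Local Open Scope ring_scope.

(** Serves to let [e] tend to 0 in estimates with an error linear in [e]; the restriction [e < 1]
    lets callers absorb [e ^+ 2] into [e]. *)
Lemma le_linear_perturbation (R : realFieldType) (a b k : R) :
  (forall e, 0 < e -> e < 1 -> a <= b + e * k) -> a <= b.
Proof.
move=> H; rewrite leNgt; apply/negP => ba.
have k1 : 0 < `|k| + 1 + (a - b) by have := normr_ge0 k; lra.
pose e := (a - b) / (`|k| + 1 + (a - b)).
have e0 : 0 < e by rewrite divr_gt0// subr_gt0.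
have e1 : e < 1 by rewrite /e ltr_pdivrMr// mul1r; have := normr_ge0 k; lra.
have eE : e * (`|k| + 1 + (a - b)) = a - b by rewrite /e divfK// gt_eqF.
have := H e e0 e1; have := ler_norm k; nra.
Qed.

(** * Asymptotic distance and tail pseudometric in a normed space *)

Section asymp_dist_theory.
Context {R : realType} {X : normedModType R}.
Implicit Types (x y : nat -> X) (u v : X).

Lemma bounded_fun_le x : bounded_fun x -> exists M, forall n, `|x n| <= M.
Proof.
move=> [M [_ /(_ (M + 1))]]; rewrite ltrDl ltr01 => /(_ isT) H.
by exists (M + 1) => n; apply: H.
Qed.

Lemma bounded_dist_fun x u : bounded_fun x -> bounded_fun (fun n => `|x n - u|).
Proof.
move=> /bounded_fun_le[M xM]; exists (M + `|u|); split; first exact: num_real.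
move=> K MK n _ /=; rewrite normr_id (le_trans (ler_normB _ _))//.
by rewrite (le_trans _ (ltW MK))// lerD2r.
Qed.

Lemma asymp_dist_le x u c : bounded_fun x ->
  (exists N, forall n, (N <= n)%N -> `|x n - u| <= c) -> asymp_dist x u <= c.
Proof.
move=> bx [N xN]; have bxu := bounded_dist_fun x u bx.
rewrite /asymp_dist limn_supE//.
apply: (@le_trans _ _ (sups (fun n => `|x n - u|) N)).
  by apply: ge_inf; [exact: bounded_fun_has_lbound_sups|exists N].
apply: ge_sup; first by exists `|x N - u|; exists N => /=.
by move=> _ [n /= Nn <-]; exact: xN.
Qed.

(** Together with [asymp_dist_le], this replaces the limit superior by eventual bounds, the only
    form used from here on. *)
Lemma asymp_dist_near x u e : bounded_fun x -> 0 < e ->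
  exists N, forall n, (N <= n)%N -> `|x n - u| <= asymp_dist x u + e.
Proof.
move=> bx e0; have bxu := bounded_dist_fun x u bx.
have hinf : has_inf (range (sups (fun n => `|x n - u|))).
  split; last exact: bounded_fun_has_lbound_sups.
  by exists (sups (fun n => `|x n - u|) 0%N); exists 0%N.
have [_ [N _ <-] HN] := inf_adherent e0 hinf.
exists N => n Nn; rewrite /asymp_dist limn_supE//.
apply: le_trans (ltW HN); apply: ub_le_sup; last by exists n.
have [M uM] := bounded_fun_has_ubound bxu.
by exists M => _ [m _ <-]; apply: uM; exists m.
Qed.

Lemma asymp_dist_ge0 x u : bounded_fun x -> 0 <= asymp_dist x u.
Proof.
move=> bx; apply/ler_addgt0Pr => e e0.
by have [N /(_ _ (leqnn N))] := asymp_dist_near x u e bx e0; apply: le_trans.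
Qed.

Lemma asymp_dist_sqr_le x u c : bounded_fun x ->
  (exists N, forall n, (N <= n)%N -> `|x n - u| ^+ 2 <= c) ->
  asymp_dist x u ^+ 2 <= c.
Proof.
move=> bx [N xN]; have c0 : 0 <= c by rewrite (le_trans _ (xN _ (leqnn N)))// sqr_ge0.
rewrite -[leRHS]sqr_sqrtr// lerXn2r// ?nnegrE ?sqrtr_ge0 ?asymp_dist_ge0//.
apply: asymp_dist_le => //; exists N => n /xN.
by rewrite -(ler_sqrt _ c0) sqrtr_sqr normr_id.
Qed.

Lemma asymp_dist_lipschitz x u v : bounded_fun x ->
  asymp_dist x u <= asymp_dist x v + `|v - u|.
Proof.
move=> bx; apply/ler_addgt0Pr => e e0; apply: asymp_dist_le => //.
have [N xN] := asymp_dist_near x v e bx e0; exists N => n /xN H.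
by rewrite (le_trans (ler_distD v _ _))// addrAC lerD2r.
Qed.

Lemma has_inf_asymp_dist x : bounded_fun x ->
  has_inf [set asymp_dist x u | u in [set: X]].
Proof.
move=> bx; split; first by exists (asymp_dist x 0), 0.
by exists 0 => _ [u _ <-]; exact: asymp_dist_ge0.
Qed.

Lemma asymp_radius_le x u : bounded_fun x -> asymp_radius x <= asymp_dist x u.
Proof. by move=> /has_inf_asymp_dist[_ lb]; apply: ge_inf => //; exists u. Qed.

Lemma asymp_radius_ge0 x : bounded_fun x -> 0 <= asymp_radius x.
Proof.
move=> bx; apply: lb_le_inf; first by have [] := has_inf_asymp_dist x bx.
by move=> _ [u _ <-]; exact: asymp_dist_ge0.
Qed.

Lemma thicken_dist (A : set X) (e : R) u : 0 < e ->
  thicken A e u <-> exists2 a, A a & `|u - a| <= e.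
Proof.
move=> e0; split=> [[a Aa [b /= b1 <-]]|[a Aa ua]].
  exists a => //; rewrite addrC addKr normrZ gtr0_norm//.
  by rewrite -[leRHS]mulr1 ler_pM2l.
exists a => //; exists (e^-1 *: (u - a)); last first.
  by rewrite scalerA divff ?gt_eqF// scale1r addrC subrK.
by rewrite /unit_ball /= normrZ gtr0_norm ?invr_gt0// mulrC ler_pdivrMr// mul1r.
Qed.

(** Every late [x n] lies within [e] of some late [y k], so the triangle inequality through [y k]
    suffices. *)
Lemma asymp_dist_tail_le x y u e : bounded_fun x -> bounded_fun y -> 0 < e ->
  (forall n, exists m, tail x m `<=` thicken (tail y n) e) ->
  asymp_dist x u <= asymp_dist y u + e.
Proof.
move=> bx by_ e0 xy; apply/ler_addgt0Pr => d d0; apply: asymp_dist_le => //.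
have [N yN] := asymp_dist_near y u d by_ d0.
have [m xm] := xy N; exists m => n mn.
have /thicken_dist[//|_ [k /= Nk <-] xnk] := xm (x n) (ex_intro2 _ _ n mn erefl).
have := yN k Nk; have := ler_distD (y k) (x n) u; lra.
Qed.

Definition tail_gaps x y : set R := [set e : R | 0 < e /\ forall n, exists m,
  tail x m `<=` thicken (tail y n) e /\ tail y m `<=` thicken (tail x n) e].

Lemma tail_gaps_nonempty x y : bounded_fun x -> bounded_fun y ->
  tail_gaps x y !=set0.
Proof.
move=> /bounded_fun_le[M xM] /bounded_fun_le[K yK].
have M0 : 0 <= M := le_trans (normr_ge0 _) (xM 0%N).
have K0 : 0 <= K := le_trans (normr_ge0 _) (yK 0%N).
have e0 : 0 < M + K + 1 by lra.
(* Any two terms are at distance at most [M + K]; the extra 1 ensures positivity. *)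
exists (M + K + 1); split => // n; exists 0%N.
split=> _ [m _ <-]; apply/thicken_dist => //.
- exists (y n); first by exists n => /=.
  by have := ler_normB (x m) (y n); have := xM m; have := yK n; lra.
- exists (x n); first by exists n => /=.
  by have := ler_normB (y m) (x n); have := yK m; have := xM n; lra.
Qed.

Lemma tail_dist_ge0 x y : bounded_fun x -> bounded_fun y -> 0 <= tail_dist x y.
Proof.
move=> bx by_; apply: lb_le_inf; first exact: tail_gaps_nonempty.
by move=> e [/ltW].
Qed.

Lemma tail_distC x y : tail_dist x y = tail_dist y x.
Proof.
congr inf; apply/seteqP; split=> e [e0 H]; split=> // n;
  by have [m []] := H n; exists m.
Qed.

(** The infimum need not be attained: instead, [asymp_dist x u - asymp_dist y u] is a lower bound of
    all gaps. *)
Lemma asymp_dist_tail_dist x y u : bounded_fun x -> bounded_fun y ->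
  asymp_dist x u <= asymp_dist y u + tail_dist x y.
Proof.
move=> bx by_; rewrite addrC -lerBlDr.
apply: lb_le_inf; first exact: tail_gaps_nonempty.
move=> e [e0 H]; rewrite lerBlDr addrC; apply: asymp_dist_tail_le => // n.
by have [m [? _]] := H n; exists m.
Qed.

End asymp_dist_theory.

(** * Strong convexity and the asymptotic center in a Hilbert space *)

Section hilbert.
Context {R : realType} {X : completeNormedModType R} (dot : {dot X for idfun}).
Context (norm_dot : forall u : X, `|u| ^+ 2 = dot u u).
Implicit Types (x y : nat -> X) (u v : X).

Lemma sqr_norm_conv u v (t : R) :
  `|t *: u + (1 - t) *: v| ^+ 2 =
  t * `|u| ^+ 2 + (1 - t) * `|v| ^+ 2 - t * (1 - t) * `|u - v| ^+ 2.
Proof.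
have dotC p q : dot p q = dot q p by rewrite hermitian_subproof expr0 mul1r.
have dotD p q w : dot (p + q) w = dot p w + dot q w by exact: linearDl.
have dotZ a p q : dot (a *: p) q = a * dot p q by exact: linearZl_LR.
rewrite !norm_dot -(scaleN1r v) !dotD !dotZ.
rewrite !(dotC _ (_ + _)) !dotD !dotZ (dotC v u); ring.
Qed.

(** The correction term of [sqr_norm_conv] does not depend on [n], so it survives the passage to the
    limit superior. *)
Lemma asymp_dist_sqr_conv x u v (t : R) : bounded_fun x -> 0 <= t <= 1 ->
  asymp_dist x (t *: u + (1 - t) *: v) ^+ 2 <=
  t * asymp_dist x u ^+ 2 + (1 - t) * asymp_dist x v ^+ 2
  - t * (1 - t) * `|u - v| ^+ 2.
Proof.
move=> bx /andP[t0 t1].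
set fu := asymp_dist x u; set fv := asymp_dist x v.
(* For [e < 1], [(f + e) ^+ 2 <= f ^+ 2 + e * (2 * f + 1)]; the slope is the convex combination of
   these errors. *)
apply: (@le_linear_perturbation _ _ _ (t * (2 * fu + 1) + (1 - t) * (2 * fv + 1))).
move=> e e0 e1; apply: asymp_dist_sqr_le => //.
have [N xN] := asymp_dist_near x u e bx e0.
have [K xK] := asymp_dist_near x v e bx e0.
exists (maxn N K) => n; rewrite geq_max => /andP[/xN Hu /xK Hv].
have -> : x n - (t *: u + (1 - t) *: v) = t *: (x n - u) + (1 - t) *: (x n - v).
  by rewrite !scalerBr addrACA -scalerDl [t + _]addrC subrK scale1r opprD.
rewrite sqr_norm_conv.
have -> : x n - u - (x n - v) = - (u - v) by rewrite !opprB addrC addrA subrK.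
rewrite normrN.
have sqr_bound (a f : R) : 0 <= a -> a <= f + e ->
  a ^+ 2 <= f ^+ 2 + e * (2 * f + 1) by move=> *; nra.
have := ler_wpM2l t0 (sqr_bound _ _ (normr_ge0 _) Hu).
have t10 : 0 <= 1 - t by lra.
have := ler_wpM2l t10 (sqr_bound _ _ (normr_ge0 _) Hv).
rewrite -/fu -/fv; lra.
Qed.

(** Compare [c] with the point [(1 - e) *: c + e *: u] by strong convexity, divide by [e], and let
    [e] tend to 0. *)
Lemma asymp_dist_sqr_growth x c u : bounded_fun x ->
  asymp_dist x c = asymp_radius x ->
  asymp_radius x ^+ 2 + `|c - u| ^+ 2 <= asymp_dist x u ^+ 2.
Proof.
move=> bx cx; apply: (@le_linear_perturbation _ _ _ (`|c - u| ^+ 2)) => e e0 e1.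
have t01 : 0 <= 1 - e <= 1 by lra.
have := asymp_dist_sqr_conv x c u (1 - e) bx t01; rewrite cx.
have : asymp_radius x ^+ 2 <= asymp_dist x ((1 - e) *: c + (1 - (1 - e)) *: u) ^+ 2.
  by rewrite lerXn2r ?nnegrE ?asymp_radius_ge0 ?asymp_dist_ge0 ?asymp_radius_le.
move=> h1 /(le_trans h1) h2; rewrite -(ler_pM2l e0); lra.
Qed.

(** The sets [A d] of near-minimizers generate a filter, Cauchy by strong convexity at midpoints;
    its limit is a minimizer. *)
Lemma asymp_center_exists x : bounded_fun x ->
  exists c, asymp_dist x c = asymp_radius x.
Proof.
move=> bx; set r := asymp_radius x.
have r0 : 0 <= r by exact: asymp_radius_ge0.
pose A (d : R) := [set u | asymp_dist x u < r + d].
pose F := filter_from [set d : R | 0 < d] A.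
have A0 d : 0 < d -> A d !=set0.
  move=> d0; have [_ [u _ <-] H] := inf_adherent d0 (has_inf_asymp_dist x bx).
  by exists u.
have FF : ProperFilter F.
  apply: filter_from_proper => //; apply: filter_from_filter; first by exists 1 => /=.
  move=> i j /= i0 j0; exists (Num.min i j); first by rewrite /= lt_min i0.
  move=> u /= ; rewrite /A /= => H; split; apply: lt_le_trans H _;
    by rewrite lerD2l ge_min lexx ?orbT.
have : cvg F.
  apply/cauchy_cvgP/cauchyP => e e0.
  have q0 : 0 < 8 * (2 * r + 1) + e ^+ 2 by have := exprn_gt0 2 e0; lra.
  (* The midpoint inequality will give [|u - v|^2 <= 4 d (2 r + 1)], which this [d] keeps below
     [e ^+ 2]; the summand [e ^+ 2] in the denominator forces [d < 1]. *)
  pose d := e ^+ 2 / (8 * (2 * r + 1) + e ^+ 2).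
  have d0 : 0 < d by rewrite divr_gt0// exprn_gt0.
  have d1 : d < 1 by rewrite ltr_pdivrMr// mul1r; lra.
  have dE : d * (8 * (2 * r + 1) + e ^+ 2) = e ^+ 2 by rewrite divfK// gt_eqF.
  have [u Au] := A0 d d0; exists u, d => // v Av.
  rewrite -ball_normE /=.
  have h01 : 0 <= (2^-1 : R) <= 1 by lra.
  have := asymp_dist_sqr_conv x u v 2^-1 bx h01.
  set w := 2^-1 *: u + _.
  have rw : r <= asymp_dist x w by exact: asymp_radius_le.
  have sqr_bound z : A d z -> asymp_dist x z ^+ 2 <= r ^+ 2 + d * (2 * r + 1).
    rewrite /A /= => Az; have := asymp_dist_ge0 x z bx; nra.
  have := sqr_bound u Au; have := sqr_bound v Av.
  have rw2 : r ^+ 2 <= asymp_dist x w ^+ 2 by rewrite lerXn2r ?nnegrE// (le_trans r0).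
  move=> h1 h2 h3.
  rewrite -(@ltr_pXn2r _ 2) ?nnegrE ?(ltW e0)//.
  have : 0 < d * (2 * r + 1) by rewrite mulr_gt0//; lra.
  have : 0 < d * e ^+ 2 by rewrite mulr_gt0// exprn_gt0.
  lra.
move=> /cvg_ex[c Fc]; exists c; apply/eqP; rewrite eq_le asymp_radius_le// andbT.
apply/ler_addgt0Pr => e e0.
have e20 : 0 < e / 2 by rewrite divr_gt0.
have Fe : F (A (e / 2)) by exists (e / 2).
have Fb : F (ball c (e / 2)) by exact/Fc/nbhsx_ballx.
(* A near-minimizer close to [c]: the Lipschitz bound costs one [e / 2], near-minimality the
   other. *)
have [u [Au]] := filter_ex (filterI Fe Fb).
rewrite -ball_normE /= distrC => cu.
have := asymp_dist_lipschitz x c u bx; rewrite /A /= in Au; rewrite -/r; lra.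
Qed.

Lemma asymp_centerP x : bounded_fun x ->
  asymp_dist x (asymp_center x) = asymp_radius x.
Proof.
move=> bx; have [c cx] := asymp_center_exists x bx.
suff : [set u | asymp_center_set x = [set u]] (asymp_center x).
  move=> /= E; suff : asymp_center_set x (asymp_center x) by [].
  by rewrite E.
(* The choice operator is meaningful only once the center set is a singleton: quadratic growth at
   [c] puts any other minimizer at distance 0. *)
apply: (@getI _ [set u | asymp_center_set x = [set u]] c) => /=.
apply/seteqP; split=> [u /= ux|_ ->//].
have := asymp_dist_sqr_growth x c u bx cx; rewrite ux gerDl => cu0.
apply/eqP; rewrite eq_sym -subr_eq0 -normr_eq0 -sqrf_eq0 eq_le cu0.
exact: sqr_ge0.
Qed.

(* Stated for arbitrary minimizers because unification unfolds the choice
   operator when two terms [asymp_center x] and [asymp_center y] are compared. *)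
Lemma minimizer_dist_le x y a b : bounded_fun x -> bounded_fun y ->
  asymp_dist x a = asymp_radius x -> asymp_dist y b = asymp_radius y ->
  `|a - b| ^+ 2 <=
    tail_dist x y * (asymp_radius x + asymp_radius y + tail_dist x y).
Proof.
move=> bx by_ ax yb.
have := asymp_dist_sqr_growth x a b bx ax.
have := asymp_dist_sqr_growth y b a by_ yb; rewrite [`|b - a|]distrC.
have := asymp_dist_tail_dist x y b bx by_.
have := asymp_dist_tail_dist y x a by_ bx; rewrite (tail_distC y x) ax yb.
have sqr_bound (p q : R) : 0 <= p -> p <= q -> p ^+ 2 <= q ^+ 2.
  by move=> p0 pq; rewrite lerXn2r ?nnegrE ?(le_trans p0).
move=> /(sqr_bound _ _ (asymp_dist_ge0 _ _ by_)) h1.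
move=> /(sqr_bound _ _ (asymp_dist_ge0 _ _ bx)) h2 h3 h4.
(* With radii [r], [s] and tail distance [d]: [(r + d)^2 - r^2 + (s + d)^2 - s^2 = 2 d (r + s +
   d)]. *)
lra.
Qed.

End hilbert.

Theorem theorem3p10 (R : realType) (X : completeNormedModType R)
    (dot : {dot X for idfun}) (norm_dot : forall u : X, `|u| ^+ 2 = dot u u)
    (x y : nat -> X) (hx : bounded_fun x) (hy : bounded_fun y) :
  `|asymp_center x - asymp_center y| ^+ 2 <=
    tail_dist x y * (asymp_radius x + asymp_radius y + tail_dist x y).
Proof.
apply: (minimizer_dist_le dot norm_dot) => //.
- exact: (asymp_centerP dot norm_dot).
- exact: (asymp_centerP dot norm_dot).
Qed.
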